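(* Let $1\le m<n$ be integers, let $a\in\mathbb{C}$ with $a\neq 0$, and let $A$ be an $m\times m$ compression of $J_n(a)$. Then $W(A)\subsetneqq W(J_n(a))$.
   Context: For $n\ge 1$ and $a\in\mathbb{C}$, the KMS matrix $J_n(a)$ is the $n\times n$ strictly upper-triangular matrix whose $(i,j)$ entry is $a^{j-i}$ if $i<j$ and $0$ if $i\ge j$. The numerical range of an $n\times n$ complex matrix $A$ is $W(A)=\{\langle Ax,x\rangle: x\in\mathbb{C}^n,\ \|x\|=1\}$. An $m\times m$ matrix $A$ is a compression of an $n\times n$ matrix $B$ if $A=V^*BV$ for some $n\times m$ matrix $V$ with $V^*V=I_m$. *)

(* Defs.v *)
From mathcomp Require Import all_boot all_order all_algebra.
From mathcomp Require Import sesquilinear spectral.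
From mathcomp Require Import classical_sets reals.
From mathcomp Require Import complex.

Set Implicit Arguments.
Unset Strict Implicit.
Unset Printing Implicit Defensive.

Import Order.TTheory GRing.Theory Num.Theory.

Local Open Scope ring_scope.
Local Open Scope sesquilinear_scope.
Local Open Scope classical_set_scope.
Local Open Scope complex_scope.

Definition KMS (R : realType) (n : nat) (a : R[i]) : 'M[R[i]]_n :=
  \matrix_(i < n, j < n) (if (i < j)%N then a ^+ (j - i) else 0).

(* [dotmx] is the Hermitian product of row vectors, linear in the first
   argument and conjugate-linear in the second. *)
Definition cdot (R : realType) (n : nat) (x y : 'cV[R[i]]_n) : R[i] :=
  dotmx x^T y^T.

Definition cnorm (R : realType) (n : nat) (x : 'cV[R[i]]_n) : R[i] :=
  sqrtC (cdot x x).

Definition numrange (R : realType) (n : nat) (A : 'M[R[i]]_n) : set R[i] :=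
  [set z | exists x : 'cV[R[i]]_n, cnorm x = 1 /\ z = cdot (A *m x) x].

Definition compression (R : realType) (m n : nat)
    (A : 'M[R[i]]_m) (B : 'M[R[i]]_n) : Prop :=
  exists V : 'M[R[i]]_(n, m), V ^t* *m V = 1%:M /\ A = V ^t* *m B *m V.

(* Main.v *)
(* Idea.  With J = KMS n a, the sequence y = (1 - a N)^-1 x (N the shift) turns
   (om J + om^* J^* ) x = lam x into a three-term recurrence, so that x is
   expressed through a Lucas sequence whose two roots u, v satisfy B(u) = B(v),
   B(z) = z^n (z - a) / (1 - a^* z).
   If W(A) = W(J), then for every om the range of V contains an eigenvector for
   the largest eigenvalue of om J + om^* J^*; a row w annihilating V then gives
   f(u) = f(v) for a nonzero polynomial f = (z - a) g of degree at most n.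
   For |a| <> 1 the polynomial (B(u) - B(v)) / (u - v) is of degree n in v and of
   Eisenstein type at u = a, so it has only finitely many common zeros with
   (f(u) - f(v)) / (u - v), of degree less than n in v; for |a| = 1 one of the
   roots is a itself. Hence only finitely many values of om / om^* can occur. *)

Require Import Defs.
From mathcomp Require Import all_boot all_order all_algebra.
From mathcomp Require Import sesquilinear spectral.
From mathcomp Require Import classical_sets reals complex.
From mathcomp Require Import ring.

Set Implicit Arguments.
Unset Strict Implicit.
Unset Printing Implicit Defensive.

Import Order.TTheory GRing.Theory Num.Theory.

Local Open Scope classical_set_scope.
Local Open Scope complex_scope.
Local Open Scope ring_scope.

(** Nonvanishing is demanded inside the subset type, so that a root list can be chosen as a function
    of [p] before [p != 0] is known. *)
Lemma closed_field_roots_seq (C : closedFieldType) (p : {poly C}) :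
  {s : seq C | p != 0 -> forall x, p.[x] = 0 -> x \in s}.
Proof.
have [s ps] := closed_field_poly_normal p; exists s => p0 x px0.
rewrite -root_prod_XsubC -(rootZ _ _ (a := lead_coef p)) ?lead_coef_eq0//.
by rewrite -ps; apply/rootP.
Qed.

(** * Elimination of the second root on the curve *)

Section CompanionPencil.
Variables (C : closedFieldType) (N : nat) (a b : C).

(* With n = N.+1, the substitution u = a + t^n, v = t c resolves the ramification at (a, 0):
   dividing by t^n, the curve (B(u) - B(v)) / (u - v) = 0 becomes an equation of
   degree n in c, and at t = 0 it has no root c = 0. *)
Definition branch : {poly C} := a%:P + 'X ^+ N.+1.
Definition cobranch : {poly C} := 1 - b *: branch.

(** Companion matrix in c of the curve equation divided by t^n, multiplied by [cobranch] so that its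
    entries are polynomials in t. *)
Definition companion_pencil : 'M[{poly C}]_N.+1 :=
  \matrix_(i, j) if (i < N)%N then (cobranch *+ (j == i.+1 :> nat))
    else - (if (j : nat) is k.+1 then cobranch * branch ^+ (N - k.+1) * 'X ^+ k.+1
            else branch ^+ N).

Lemma branchE (t : C) : branch.[t] = a + t ^+ N.+1.
Proof. by rewrite !hornerE. Qed.

Lemma cobranchE (t : C) : cobranch.[t] = 1 - b * (a + t ^+ N.+1).
Proof. by rewrite /cobranch hornerD hornerN hornerZ hornerC branchE. Qed.

Lemma companion_pencil_eigen (t c : C) :
  cobranch.[t] * c ^+ N.+1 =
    - (branch.[t] ^+ N
       + cobranch.[t] * \sum_(i < N) branch.[t] ^+ (N - i.+1) * (t * c) ^+ i.+1) ->
  map_mx (horner_eval t) companion_pencil *m (\col_i c ^+ i)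
    = (cobranch.[t] * c) *: (\col_i c ^+ i).
Proof.
move=> ceq; apply/matrixP => i j; rewrite !mxE.
have [iN|iN] := ltnP i N.
  have i1 : (i.+1 < N.+1)%N by [].
  rewrite (bigD1 (Ordinal i1)) //= !mxE iN eqxx /horner_eval mulr1n big1.
    by rewrite addr0 exprS mulrA.
  move=> k kn; rewrite !mxE iN /horner_eval.
  by rewrite -val_eqE /= in kn; rewrite (negbTE kn) mulr0n horner0 mul0r.
have -> : (i : nat) = N by apply/eqP; rewrite eqn_leq iN -ltnS ltn_ord.
rewrite -mulrA -exprS ceq big_ord_recl !mxE ltnNge iN /= /horner_eval.
rewrite expr0 mulr1 opprD hornerN horner_exp; congr (_ + _).
rewrite mulr_sumr -sumrN; apply: eq_bigr => k _.
rewrite !mxE ltnNge iN /= /horner_eval /= hornerN !hornerM !horner_exp hornerX.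
rewrite /bump /= exprMn; ring.
Qed.

(** At t = 0 the last row keeps only its first entry -a^N and the superdiagonal is constantly 1 - b
    a: a weighted cyclic permutation. *)
Lemma companion_pencil0_det : a != 0 -> 1 - b * a != 0 ->
  \det (map_mx (horner_eval 0) companion_pencil) != 0.
Proof.
move=> a0 ab; apply/det0P => -[v v0 vM]; case/eqP: v0.
have c0 : cobranch.[0] = 1 - b * a by rewrite cobranchE expr0n addr0.
have b0 : branch.[0] = a by rewrite branchE expr0n addr0.
have vN : v 0 ord_max = 0.
  have /matrixP /(_ 0 0) := vM.
  rewrite !mxE (bigD1 ord_max) //= big1 => [|i iN].
    rewrite !mxE ltnn /= /horner_eval hornerN horner_exp b0 addr0 => /eqP.
    by rewrite mulf_eq0 oppr_eq0 expf_eq0 (negbTE a0) andbF orbF => /eqP.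
  rewrite !mxE; suff -> : (i < N)%N by rewrite mulr0n /horner_eval horner0 mulr0.
  by rewrite ltn_neqAle -val_eqE /= in iN *; rewrite iN -ltnS ltn_ord.
apply/matrixP => z i; rewrite !ord1 mxE {z}.
have [iN|iN] := ltnP i N; last first.
  rewrite -vN; congr (v _ _); apply/val_inj/eqP.
  by rewrite eqn_leq iN -ltnS ltn_ord.
have i1 : (i.+1 < N.+1)%N by [].
have /matrixP /(_ 0 (Ordinal i1)) := vM.
rewrite !mxE (bigD1 i) //= big1 => [|k ki].
  rewrite !mxE iN eqxx /horner_eval mulr1n c0 addr0 => /eqP.
  by rewrite mulf_eq0 (negbTE ab) orbF => /eqP.
rewrite !mxE; case: ifP => kN; rewrite /horner_eval.
  rewrite eqSS eq_sym val_eqE (negbTE ki) mulr0n horner0 mulr0 //.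
by rewrite /= hornerN hornerM horner_exp hornerX expr0n /= mulr0 oppr0 mulr0.
Qed.

(** The second equation is (B(x) - B(y)) / (x - y) = 0, cleared of denominators and sorted by powers
    of y. A common zero with x != a gives t with t^n = x - a where one matrix over C[t] is singular,
    so t is a root of its determinant. *)
Lemma finite_common_zeros (g : {poly C}) :
    a != 0 -> 1 - b * a != 0 -> g != 0 -> (size g <= N.+1)%N ->
  exists s : seq C, forall x y,
    (x - a) * g.[x] = (y - a) * g.[y] ->
    (1 - b * x) * y ^+ N.+1 =
      - ((x - a) * (x ^+ N + (1 - b * x) * \sum_(i < N) x ^+ (N - i.+1) * y ^+ i.+1)) ->
    x \in s.
Proof.
move=> a0 ab g0 gN.
have [j [h h0 gE]] := multiplicity_XsubC g 0.
rewrite g0 /= in h0; rewrite subr0 in gE.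
have hn0 : h != 0 by apply: contraNneq h0 => ->; rewrite root0.
have hjN : (size h + j <= N.+1)%N.
  by move: gN; rewrite gE size_mulXn // addnC.
(* The degree bound on g is used here: the power t^(N+1-j) in [Psi] has a positive exponent and
   vanishes at t = 0. *)
have jN : (j <= N)%N.
  move: hjN; rewrite -size_poly_gt0 in hn0; rewrite -(prednK hn0) addSn ltnS.
  exact/leq_trans/leq_addl.
(* With f = (z - a) g and g = z^j h, the matrix [Psi] encodes
   (f(u) - f(v)) / t^j; it is regular at t = 0, so its determinant is a
   nonzero polynomial in t. *)
pose Psi : 'M[{poly C}]_N.+1 :=
  ('X^(N.+1 - j) * (g \Po branch) * cobranch ^+ N.+1)%:M
  - ('X *: companion_pencil - (a *: cobranch)%:M) *m
    \sum_(i < size h) (h`_i *: ('X^i * cobranch ^+ (N - j - i)))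
       *: companion_pencil ^+ (i + j).
have PsiE t : map_mx (horner_eval t) Psi =
    (t ^+ (N.+1 - j) * g.[branch.[t]] * cobranch.[t] ^+ N.+1)%:M
    - (t *: map_mx (horner_eval t) companion_pencil - (a * cobranch.[t])%:M) *m
      \sum_(i < size h) (h`_i * (t ^+ i * cobranch.[t] ^+ (N - j - i)))
        *: map_mx (horner_eval t) companion_pencil ^+ (i + j).
  rewrite map_mxB map_mxM map_mxB map_mxZ !map_scalar_mx raddf_sum /=.
  rewrite !horner_evalE !hornerM horner_comp !horner_exp hornerX hornerZ.
  congr (_ - _ *m _); apply: eq_bigr => i _.
  by rewrite map_mxZ rmorphXn /= horner_evalE hornerZ hornerM !horner_exp hornerX.
have e0 : cobranch.[0] != 0 by rewrite cobranchE expr0n addr0.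
have Psi0 : \det Psi != 0.
  (* At t = 0 only the summand i = 0 survives: the nonzero multiple by a, h(0) and powers of
     [cobranch] of a power of the invertible companion matrix. *)
  suff: (\det Psi).[0] != 0 by apply: contraNneq => ->; rewrite horner0.
  rewrite -[_.[0]]/(horner_eval 0 _) -det_map_mx PsiE.
  rewrite expr0n subn_eq0 ltnNge jN /= !mul0r raddf0 scale0r !sub0r mulNmx opprK.
  rewrite mul_scalar_mx detZ mulf_neq0 ?expf_neq0 ?mulf_neq0//.
  have hs : (0 < size h)%N by rewrite size_poly_gt0.
  rewrite -(prednK hs) big_ord_recl big1 => [|i _]; last first.
    by rewrite expr0n mul0r mulr0 scale0r.
  rewrite addr0 expr0 mul1r detZ mulf_neq0 ?expf_neq0 ?mulf_neq0 ?expf_neq0//.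
    by rewrite -horner_coef0 -rootE.
  rewrite -unitfE -[X in is_true X]unitmxE; apply: unitrX.
  by rewrite -[_ \is a _]/(_ \in unitmx) unitmxE unitfE companion_pencil0_det.
have [s /(_ Psi0) sP] := closed_field_roots_seq (\det Psi).
(* The point x = a is listed apart, since t = 0 there and y cannot be divided by t. *)
exists (a :: [seq a + t ^+ N.+1 | t <- s]) => x y fxy Pxy.
rewrite inE; have [//|xa /=] := eqVneq x a.
have [t tP] : exists t, t ^+ N.+1 = x - a.
  have [|t /rootP] := closed_rootP ('X^(N.+1) - (x - a)%:P) _.
    by rewrite size_XnsubC.
  by rewrite !hornerE => /eqP; rewrite subr_eq0 => /eqP; exists t.
have t0 : t != 0.
  by apply: contraNneq xa => t0; rewrite -subr_eq0 -tP t0 expr0n.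
have bt : branch.[t] = x by rewrite branchE tP; ring.
have et : cobranch.[t] = 1 - b * x by rewrite cobranchE tP; ring.
apply/mapP; exists t; last by rewrite tP; ring.
apply: sP; apply/eqP; rewrite -[_.[t]]/(horner_eval t _) -det_map_mx -det_tr.
have [c yE] : exists c, y = t * c by exists (y / t); rewrite mulrC divfK.
have Mv := @companion_pencil_eigen t c.
apply/det0P; exists (\col_i c ^+ i)^T.
  apply/eqP => /matrixP/(_ 0 0); rewrite !mxE => /eqP.
  by rewrite expr0 oner_eq0.
rewrite -trmx_mul; apply/trmx_inj; rewrite trmxK trmx0.
rewrite bt et -yE in Mv.
set v := \col_i _ in Mv *; set M := map_mx _ companion_pencil in Mv.
have {}Mv : M *m v = ((1 - b * x) * c) *: v.
  apply: Mv; apply: (mulfI (expf_neq0 N.+1 t0)).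
  by rewrite mulrCA -exprMn -yE Pxy tP mulrN.
have MXv k : M ^+ k *m v = ((1 - b * x) * c) ^+ k *: v.
  elim: k => [|k IH]; first by rewrite !expr0 mul1mx scale1r.
  by rewrite exprS -mulmxE -mulmxA IH -scalemxAr Mv scalerA -exprSr.
rewrite PsiE -/M mulmxBl -mulmxA mulmx_suml.
under eq_bigr do rewrite -scalemxAl MXv scalerA.
rewrite -scaler_suml -scalemxAr mulmxBl -scalemxAl Mv !mul_scalar_mx scalerA.
rewrite -scalerBl scalerA -scalerBl.
(* The vector of powers of c is an eigenvector of [Psi] at t. Multiplied by t^j, its eigenvalue is
   e^n ((x - a) g(x) - (y - a) g(y)), which is zero by [fxy]. *)
rewrite [X in X *: v](_ : _ = 0) ?scale0r//.
rewrite bt et; set e := 1 - b * x.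
have -> : \sum_(i < size h) h`_i * (t ^+ i * e ^+ (N - j - i)) * (e * c) ^+ (i + j)
    = e ^+ N * c ^+ j * h.[y].
  rewrite horner_coef mulr_sumr; apply: eq_bigr => i _.
  have ijN : (i + j <= N)%N.
    by rewrite -ltnS; apply: leq_trans hjN; rewrite -addSn leq_add2r.
  rewrite -subnDA [(j + i)%N]addnC -[in e ^+ N](subnK ijN) yE !exprMn !exprD.
  ring.
apply: (mulfI (expf_neq0 j t0)); rewrite mulr0.
have -> : t ^+ j * (t ^+ (N.+1 - j) * g.[x] * e ^+ N.+1
     - e ^+ N * c ^+ j * h.[y] * (t * (e * c) - a * e))
   = e ^+ N.+1 * (t ^+ (j + (N.+1 - j)) * g.[x] - (t * c - a) * (h.[y] * (t * c) ^+ j)).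
  rewrite exprD exprMn (exprS e); ring.
rewrite subnKC ?(leq_trans jN)// tP -yE fxy gE hornerM hornerXn.
by rewrite subrr mulr0.
Qed.
End CompanionPencil.

(** * Lucas sequences and finiteness of the admissible pairs (x, l) *)

Section LucasSequence.
Variable R : comNzRingType.

(** The Lucas sequence U_k(d, x), equal to (u^k - v^k) / (u - v) when z^2 - d z + x has distinct
    roots u, v. Iterating on pairs makes the recurrence hold by conversion. *)
Definition lucas (d x : R) (k : nat) : R :=
  (iter k (fun u => (u.2, d * u.2 - x * u.1)) (0, 1)).1.

Lemma lucasSS d x k : lucas d x k.+2 = d * lucas d x k.+1 - x * lucas d x k.
Proof. by []. Qed.

Lemma lucasS u v k :
  lucas (u + v) (u * v) k.+1 = u * lucas (u + v) (u * v) k + v ^+ k.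
Proof.
elim: k => [|k IH]; first by rewrite /lucas /= mulr0 add0r.
by rewrite lucasSS IH exprS; ring.
Qed.

Lemma lucasE u v k :
  lucas (u + v) (u * v) k = \sum_(i < k) u ^+ (k - i.+1) * v ^+ i.
Proof.
elim: k => [|k IH]; first by rewrite big_ord0.
rewrite lucasS big_ord_recr /= subnn expr0 mul1r IH mulr_sumr; congr (_ + _).
by apply: eq_bigr => i _; rewrite subSS mulrA -exprS subnSK.
Qed.

Lemma lucas_sub u v k :
  (u - v) * lucas (u + v) (u * v) k = u ^+ k - v ^+ k.
Proof.
rewrite lucasE subrXX; congr (_ * _); apply: eq_bigr => i _.
by rewrite -subn1 -subnDA add1n.
Qed.

Lemma backward_recurrence (y : nat -> R) n d x : y n.+1 = 0 ->
    (forall k, (k.+1 < n.+1)%N -> y k = d * y k.+1 - x * y k.+2) ->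
  forall k, (k <= n.+1)%N -> y (n.+1 - k)%N = y n * lucas d x k.
Proof.
move=> yn rec k; elim/ltn_ind: k => -[_ _|[_ _|k IH kn]].
- by rewrite subn0 yn mulr0.
- by rewrite subn1 /lucas /= mulr1.
rewrite rec; last by rewrite subnSK // subSS ltnS leq_subr.
rewrite !subnSK ?(ltnW kn)// !IH ?(ltnW kn) ?(ltnW (ltnW kn))// lucasSS.
ring.
Qed.
End LucasSequence.

(** Write d = u + v and x = u v. The vanishing sum, multiplied by u - v, becomes f(u) = f(v), and if
    a b != 1 the equation in l becomes the curve of [finite_common_zeros]. *)
Lemma finite_pencil_points (C : closedFieldType) N (a b : C) (g : {poly C}) :
    a != 0 -> b != 0 -> g != 0 -> (size g <= N.+1)%N ->
  exists s : seq (C * C), forall x l d, x != 0 ->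
    d = (1 - a * b) * l + b * x + a ->
    l * lucas d x N.+1 = x * lucas d x N ->
    \sum_(k < N.+1) g`_k * (lucas d x k.+1 - a * lucas d x k) = 0 ->
    (x, l) \in s.
Proof.
move=> a0 b0 g0 gN; pose f : {poly C} := ('X - a%:P) * g.
have f0 : f != 0 by rewrite mulf_neq0 ?polyXsubC_eq0.
have fE z : f.[z] = (z - a) * g.[z] by rewrite /f hornerM hornerXsubC.
have fuv u v :
    \sum_(k < N.+1) g`_k * (lucas (u + v) (u * v) k.+1 - a * lucas (u + v) (u * v) k) = 0 ->
    f.[u] = f.[v].
  move=> /(congr1 (fun z => (u - v) * z)); rewrite mulr0 => h.
  apply/eqP; rewrite -subr_eq0 -h !fE !(horner_coef_wide _ gN); apply/eqP.
  rewrite !mulr_sumr -sumrB; apply: eq_bigr => k _.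
  rewrite [RHS]mulrCA [(u - v) * _]mulrBr [(u - v) * (a * _)]mulrCA !lucas_sub.
  by rewrite !exprS; ring.
(* If a b = 1, then l drops out of d and the two roots are a and v = b x; hence f(v) = f(a) = 0. *)
have [ab|ab] := eqVneq (a * b) 1.
  have [s /(_ f0) sP] := closed_field_roots_seq f.
  exists [seq (a * z, a * z * lucas (a + z) (a * z) N / lucas (a + z) (a * z) N.+1)
         | z <- s] => x l d x0.
  rewrite ab subrr mul0r add0r => dE.
  have [v [xE {}dE]] : exists v, x = a * v /\ d = a + v.
    by exists (b * x); rewrite mulrA ab mul1r dE addrC.
  move: x0; rewrite {}dE {}xE {x d} mulf_eq0 (negbTE a0) /= => v0.
  move=> lE /fuv/esym; rewrite (fE a) subrr mul0r => /sP vs.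
  apply/mapP; exists v => //; congr (_, _).
  (* Two consecutive Lucas terms cannot both vanish, because U_(N+1) = a U_N + v^N. *)
  rewrite -lE mulfK//; apply/eqP => u0; move: lE.
  rewrite u0 mulr0 => /esym/eqP; rewrite !mulf_eq0 (negbTE a0) (negbTE v0) /=.
  move=> /eqP u1; move/eqP: u0.
  by rewrite lucasS u1 mulr0 add0r expf_eq0 (negbTE v0) andbF.
have ab' : 1 - a * b != 0 by rewrite subr_eq0 eq_sym.
have ba : 1 - b * a != 0 by rewrite mulrC.
have [s sP] := finite_common_zeros a0 ba g0 gN.
pose roots u := sval (closed_field_roots_seq (f - f.[u]%:P)).
(* Given u, the root v is a zero of f - f(u), which is nonzero since a constant f would equal f(a) =
   0; then l is solved from the formula for d. *)
exists [seq (u * v, (u + v - b * (u * v) - a) / (1 - a * b)) | u <- s, v <- roots u].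
move=> x l d x0 dE.
have [u [v [uvd uvx]]] : exists u v, u + v = d /\ u * v = x.
  have [u uE] := @solve_monicpoly C 2 (nth 0 [:: - x; d]) isT.
  exists u, (d - u); split; first by ring.
  move: uE; rewrite !big_ord_recl big_ord0 /= expr0 => uE.
  rewrite (_ : u * (d - u) = d * u - u ^+ 2); last by ring.
  by rewrite uE; ring.
rewrite -uvd -uvx => lE /fuv fuvE.
have us : u \in s.
  apply: (sP u v); first by rewrite -!fE.
  have -> : \sum_(i < N) u ^+ (N - i.+1) * v ^+ i.+1 = v * lucas (u + v) (u * v) N.
    by rewrite lucasE mulr_sumr; apply: eq_bigr => i _; rewrite exprS; ring.
  have uN := lucas_sub u v N; move: lE; rewrite lucasS.
  move: (lucas _ _ _) uN => G uN lE.
  have -> : u ^+ N = v ^+ N + (u - v) * G by rewrite uN; ring.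
  have {}lE : (u + v - b * (u * v) - a) * (u * G + v ^+ N) = (1 - a * b) * (u * v * G).
    by rewrite -lE mulrA; congr (_ * _); rewrite uvd uvx dE; ring.
  apply/eqP; rewrite -subr_eq0 exprS -[X in _ == X](subrr ((1 - a * b) * (u * v * G))).
  by rewrite -{1}lE; apply/eqP; ring.
apply/allpairsPdep; exists u, v; split => //.
  have fu0 : f - f.[u]%:P != 0.
    apply: contraNneq f0 => /eqP; rewrite subr_eq0 => /eqP fc.
    have : f.[a] = 0 by rewrite fE subrr mul0r.
    by rewrite fc hornerC => ->.
  rewrite /roots; case: closed_field_roots_seq => r /= ->//.
  by rewrite hornerD hornerN hornerC fuvE subrr.
congr (_, _); apply: (mulIf ab'); rewrite divfK //; rewrite uvd uvx dE; ring.
Qed.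

(** * From eigenvectors to Lucas sequences *)

(* [b] stands for the conjugate of [a] and [om'] for that of [om]; [u] is the
   eigenvector and [y] its image under (1 - a N)^-1. *)
Section KMSRecurrence.
Variables (F : fieldType) (N : nat) (a b om om' L : F) (u : nat -> F).
Let y k := \sum_(k <= j < N.+1) a ^+ (j - k) * u j.
Let z k := \sum_(0 <= j < k) b ^+ (k - j) * u j.
Hypothesis eigen : forall k, (k < N.+1)%N -> om * (a * y k.+1) + om' * z k = L * u k.
Hypothesis q0 : b * (L + om') != 0.

(** Coefficients of the recurrence [y_rec] after division by its leading coefficient b (L + om'). *)
Let x := a * (L + om) / (b * (L + om')).
Let l := L / (b * (L + om')).
Let d := (1 - a * b) * l + b * x + a.

Let uE k : (k < N.+1)%N -> u k = y k - a * y k.+1.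
Proof.
move=> kN; rewrite /y big_ltn // subnn expr0 mul1r big_distrr /= -addrA.
rewrite -sumrB big_nat_cond big1 ?addr0// => j /andP[/andP[kj _] _].
by rewrite -subnSK // exprS; ring.
Qed.

Let zS k : z k.+1 = b * (z k + u k).
Proof.
rewrite /z big_nat_recr //= subSnn expr1 mulrDr; congr (_ + _).
rewrite big_distrr /= !big_nat; apply: eq_bigr => j /andP[_ jk].
by rewrite subSn 1?ltnW// exprS mulrA.
Qed.

Let yN1 : y N.+1 = 0.
Proof. by rewrite /y big_geq. Qed.

Let qx : b * (L + om') * x = a * (L + om).
Proof. by rewrite mulrC divfK. Qed.

Let ql : b * (L + om') * l = L.
Proof. by rewrite mulrC divfK. Qed.

Let qd : b * (L + om') * d = L + a * b * (L + om + om').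
Proof.
have -> : b * (L + om') * d = (1 - a * b) * (b * (L + om') * l)
    + b * (b * (L + om') * x) + b * (L + om') * a by rewrite /d; ring.
by rewrite ql qx; ring.
Qed.

(** Both y and z are geometric sums, so equation k+1 minus b times equation k eliminates z. *)
Let y_rec k : (k.+1 < N.+1)%N -> y k = d * y k.+1 - x * y k.+2.
Proof.
move=> kN; have := eigen kN; have := eigen (ltnW kN).
rewrite zS !uE// ?(ltnW kN)// => e1 e2.
apply: (mulfI q0).
have -> : b * (L + om') * (d * y k.+1 - x * y k.+2)
    = (b * (L + om') * d) * y k.+1 - (b * (L + om') * x) * y k.+2 by ring.
rewrite qd qx; apply/eqP; rewrite -subr_eq0; apply/eqP.
transitivity (om * (a * y k.+2) + om' * (b * (z k + (y k - a * y k.+1)))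
    - L * (y k.+1 - a * y k.+2)
    - b * (om * (a * y k.+1) + om' * z k - L * (y k - a * y k.+1))); first by ring.
by rewrite e2 e1 !subrr mulr0 subr0.
Qed.

Let y_lucas k : (k <= N.+1)%N -> y (N.+1 - k)%N = y N * lucas d x k.
Proof. exact: backward_recurrence yN1 y_rec k. Qed.

(** At k = 0 the sum z is empty, and the eigenvector equation is the boundary condition L y_0 = a (L
    + om) y_1. *)
Lemma kms_eigen_lucas : y N != 0 -> l * lucas d x N.+1 = x * lucas d x N.
Proof.
move=> yN0; apply: (mulfI yN0).
have := eigen (ltn0Sn N).
rewrite {1}/z big_geq // mulr0 addr0 uE //.
have y0 : y 0 = y N * lucas d x N.+1 by rewrite -y_lucas // subnn.
have y1 : y 1 = y N * lucas d x N by rewrite -y_lucas // subSnn.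
move=> e; rewrite [LHS]mulrCA [RHS]mulrCA -y0 -y1.
apply: (mulfI q0); rewrite mulrA ql mulrA qx.
have -> : a * (L + om) * y 1 = om * (a * y 1) + L * (a * y 1) by ring.
by rewrite e; ring.
Qed.

(** Lucas terms count from the end of y, so u_(N-k) = y_N (U_(k+1) - a U_k) and the weights appear
    reversed. *)
Lemma kms_eigen_ortho (w : nat -> F) : y N != 0 ->
  \sum_(k < N.+1) w k * u k = 0 ->
  \sum_(k < N.+1) w (N - k)%N * (lucas d x k.+1 - a * lucas d x k) = 0.
Proof.
move=> yN0 wu; apply: (mulfI yN0); rewrite mulr0 -[RHS]wu mulr_sumr.
rewrite [RHS](reindex_inj rev_ord_inj); apply: eq_bigr => k _ /=.
have kN : (k < N.+1)%N by [].
rewrite subSS mulrCA; congr (_ * _).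
rewrite mulrBr [y N * (a * _)]mulrCA -(y_lucas kN) -(y_lucas (ltnW kN)).
by rewrite uE ?ltnS ?leq_subr// subSS subSn.
Qed.

(** Contrapositively, a nonzero eigenvector satisfies the premise y_N != 0 of the two preceding
    lemmas. *)
Lemma kms_eigen_last : y N = 0 -> forall k, (k < N.+1)%N -> u k = 0.
Proof.
move=> yN0; have y0 k : (k <= N.+1)%N -> y k = 0.
  by move=> kN; rewrite -(subKn kN) y_lucas ?leq_subr// yN0 mul0r.
by move=> k kN; rewrite uE // (y0 _ (ltnW kN)) (y0 _ kN) mulr0 subr0.
Qed.
End KMSRecurrence.

(** * Top eigenvectors of Hermitian matrices *)

Section Hermitian.
Local Open Scope sesquilinear_scope.

Lemma trmxC_mul (C : numClosedFieldType) m n p (A : 'M[C]_(m, n)) (B : 'M_(n, p)) :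
  (A *m B) ^t* = B ^t* *m A ^t*.
Proof. by rewrite trmx_mul map_mxM. Qed.

(** Let lam be the largest eigenvalue and z the coordinates of x in an orthonormal eigenbasis.
    Attaining lam means that the nonnegative terms (lam - D_i) |z_i|^2 sum to 0, so z lives on the
    top eigenspace. *)
Lemma hermitian_top_eigenvector (C : numClosedFieldType) n (H : 'M[C]_n.+1) :
  H ^t* = H ->
  exists (lam : C) (x0 : 'cV_n.+1),
    [/\ lam \is Num.real, x0 ^t* *m x0 = 1%:M, x0 ^t* *m H *m x0 = lam%:M &
      forall x : 'cV_n.+1, x ^t* *m x = 1%:M -> x ^t* *m H *m x = lam%:M ->
        H *m x = lam *: x].
Proof.
move=> HH.
have Hh : H \is hermsymmx by apply/is_hermitianmxP; rewrite expr0 scale1r HH.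
have /orthomx_spectralP HE := hermitian_normalmx Hh.
have Du : spectralmx H \is unitarymx by apply: spectral_unitarymx.
have Dr := hermitian_spectral_diag_real Hh.
move: HE Du Dr; set P := spectralmx H; set D := spectral_diag H => HE Pu Dr.
have D0 i : D 0 i \is Num.real by move/mxOverP: Dr; apply.
rewrite invmx_unitary // in HE.
have PP : P *m P ^t* = 1%:M by apply/unitarymxP.
have PP' : P ^t* *m P = 1%:M by rewrite -invmx_unitary // mulVmx // unitarymx_unit.
have [i0 _ i0max] := @real_arg_maxP C 'I_n.+1 ord0 xpredT (fun i => D 0 i) isT (fun i _ => D0 i).
pose e : 'cV[C]_n.+1 := delta_mx i0 0.
have ee : e ^t* *m e = 1%:M.
  rewrite /e trmx_delta map_delta_mx.
  by rewrite mul_delta_mx; apply/matrixP => i j; rewrite !ord1 !mxE.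
have De : diag_mx D *m e = D 0 i0 *: e.
  apply/matrixP => i j; rewrite mul_diag_mx !mxE.
  by case: eqP => [->|] //=; rewrite !mulr0.
exists (D 0 i0), (P ^t* *m e); split => //.
- by rewrite trmxC_mul trmxCK mulmxA -[_ *m P *m _]mulmxA PP mulmx1.
- rewrite trmxC_mul trmxCK HE !mulmxA -[_ *m P *m P^t*]mulmxA PP mulmx1.
  rewrite -[_ *m P *m P^t*]mulmxA PP mulmx1 -mulmxA De -scalemxAr ee.
  by rewrite scalemx1.
move=> x xx xHx; pose z := P *m x.
have zz : z ^t* *m z = 1%:M.
  by rewrite trmxC_mul mulmxA -[_ *m P^t* *m _]mulmxA PP' mulmx1.
have zDz : z ^t* *m diag_mx D *m z = (D 0 i0)%:M.
  by rewrite -xHx HE trmxC_mul !mulmxA.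
suff zD : diag_mx D *m z = D 0 i0 *: z.
  by rewrite HE -!mulmxA zD -scalemxAr /z mulmxA PP' mul1mx.
clearbody z.
have S0 : \sum_i (D 0 i0 - D 0 i) * (z i 0 * (z i 0)^*) = 0.
  move: zDz; rewrite -[_%:M]scalemx1 -zz -mulmxA => /matrixP/(_ 0 0).
  rewrite !mxE mulr_sumr => e1.
  under eq_bigr do rewrite mulrBl.
  rewrite sumrB; apply/eqP; rewrite subr_eq0; apply/eqP.
  transitivity (\sum_i D 0 i0 * ((z ^t*) 0 i * z i 0)).
    by apply: eq_bigr => i _; rewrite !mxE [_^* * _]mulrC.
  rewrite -e1; apply: eq_bigr => i _; rewrite mul_diag_mx !mxE; ring.
apply/matrixP => i j; rewrite mul_diag_mx !mxE !ord1.
have /eqP := S0; rewrite psumr_eq0 => [/allP/(_ i)|k _].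
  rewrite mem_index_enum /= => /(_ isT); rewrite mulf_eq0 mul_conjC_eq0.
  by rewrite subr_eq0 => /orP[/eqP ->//|/eqP ->]; rewrite !mulr0.
by rewrite mulr_ge0 ?mul_conjC_ge0// subr_ge0; apply: i0max.
Qed.
End Hermitian.

(** * Numerical ranges and isometries *)

Section NumericalRange.
Local Open Scope sesquilinear_scope.

Lemma cdotE (R : realType) n (x y : 'cV[R[i]]_n) : (cdot x y)%:M = y ^t* *m x.
Proof.
rewrite [RHS]mx11_scalar /cdot dotmxE; congr (_%:M).
rewrite -[in LHS](trmxK y) !mxE; apply: eq_bigr => k _; rewrite !mxE mulrC //.
Qed.

Lemma cnorm1P (R : realType) n (x : 'cV[R[i]]_n) :
  cnorm x = 1 <-> x ^t* *m x = 1%:M.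
Proof.
rewrite -cdotE /cnorm; split => [x1|/matrixP/(_ 0 0)].
  by rewrite -[cdot x x]sqrtCK x1 expr1n.
by rewrite !mxE !mulr1n => ->; rewrite sqrtC1.
Qed.

Lemma numrangeP (R : realType) n (A : 'M[R[i]]_n) (z : R[i]) :
  numrange A z <-> exists x : 'cV_n, x ^t* *m x = 1%:M /\ x ^t* *m A *m x = z%:M.
Proof.
split=> [[x [/cnorm1P x1 ->]]|[x [/cnorm1P x1 xA]]]; exists x; split=> //.
  by rewrite cdotE mulmxA.
by have := xA; rewrite -mulmxA -cdotE => /matrixP/(_ 0 0); rewrite !mxE !mulr1n.
Qed.

Lemma isometry_norm (C : numClosedFieldType) m n (V : 'M[C]_(n, m)) (x : 'cV_m) :
  V ^t* *m V = 1%:M -> (V *m x) ^t* *m (V *m x) = x ^t* *m x.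
Proof. by move=> VV; rewrite trmxC_mul mulmxA -[_ *m _ *m V]mulmxA VV mulmx1. Qed.

(** The form of H at a vector depends only on that of J. Hence some unit vector V u attains the top
    value of H, and it is an eigenvector. *)
Lemma isometry_top_eigenvector (C : numClosedFieldType) m n (J : 'M[C]_n.+1)
    (V : 'M_(n.+1, m)) (om : C) :
    V ^t* *m V = 1%:M ->
    (forall x : 'cV_n.+1, x ^t* *m x = 1%:M ->
      exists u : 'cV_m, u ^t* *m u = 1%:M /\
        (V *m u) ^t* *m J *m (V *m u) = x ^t* *m J *m x) ->
  exists (lam : C) (u : 'cV_m), [/\ lam \is Num.real, V *m u != 0 &
    (om *: J + om^* *: J ^t*) *m (V *m u) = lam *: (V *m u)].
Proof.
move=> VV full; set H := _ + _.
have HH : H ^t* = H.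
  rewrite /H linearD map_mxD !linearZ /= !map_mxZ /= trmxCK conjCK addrC //.
have [lam [x0 [lr x1 xH top]]] := hermitian_top_eigenvector HH.
have [u [u1 uJ]] := full x0 x1; exists lam, u.
have Vu1 : (V *m u) ^t* *m (V *m u) = 1%:M by rewrite isometry_norm.
split=> //.
  apply/eqP => Vu0; move/matrixP/(_ 0 0): Vu1; rewrite Vu0 mulmx0 !mxE => /eqP.
  by rewrite eq_sym oner_eq0.
apply: top => //; rewrite -xH.
have HE (y : 'cV_n.+1) : y ^t* *m H *m y
    = om *: (y ^t* *m J *m y) + om^* *: (y ^t* *m J *m y) ^t*.
  rewrite !trmxC_mul trmxCK /H mulmxDr mulmxDl -!scalemxAr -!scalemxAl.
  by rewrite !mulmxA.
by rewrite !HE uJ.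
Qed.
End NumericalRange.

(** * Eigenvectors of the KMS pencil *)

Lemma eq_big_ord_lt (M : nmodType) n k (F : nat -> M) : (k < n)%N ->
  \sum_(j < n) (if (k < j)%N then F j else 0) = \sum_(k.+1 <= j < n) F j.
Proof.
move=> kn; rewrite -(big_mkord xpredT (fun j => if (k < j)%N then F j else 0)).
rewrite (big_cat_nat (n := k.+1)) //= big_nat big1 ?add0r => [|j].
  by rewrite !big_nat; apply: eq_bigr => j /andP[-> _].
by move=> /andP[_ jk]; rewrite ltnNge -ltnS jk.
Qed.

Lemma eq_big_ord_gt (M : nmodType) n k (F : nat -> M) : (k < n)%N ->
  \sum_(j < n) (if (j < k)%N then F j else 0) = \sum_(0 <= j < k) F j.
Proof.
move=> kn; rewrite -(big_mkord xpredT (fun j => if (j < k)%N then F j else 0)).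
rewrite (big_cat_nat (n := k)) ?(ltnW kn) //= [X in _ + X]big_nat [X in _ + X]big1 ?addr0 => [|j].
  by rewrite !big_nat; apply: eq_bigr => j /andP[_ ->].
by move=> /andP[kj _]; rewrite ltnNge kj.
Qed.

(** With lam real and om nonreal, lam + om and its conjugate are nonzero, so x and l make sense and
    x != 0. The last equation recovers the slope of om from (x, l): finitely many pairs allow
    finitely many slopes. *)
Lemma KMS_eigen_pencil (R : realType) N (a om : R[i]) (lam : R[i]) (v : 'cV[R[i]]_N.+1)
    (w : 'rV[R[i]]_N.+1) :
    a != 0 -> lam \is Num.real -> om \isn't Num.real -> v != 0 ->
    (om *: KMS N.+1 a + om^* *: (KMS N.+1 a) ^t*)%sesqui *m v = lam *: v ->
    w *m v = 0 ->
  exists x l d, [/\ x != 0, d = (1 - a * a^*) * l + a^* * x + a,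
    l * lucas d x N.+1 = x * lucas d x N,
    \sum_(k < N.+1) w 0 (inord (N - k)) * (lucas d x k.+1 - a * lucas d x k) = 0 &
    a * (om / om^*) = a^* * (x - a * l) / (1 - a^* * l)].
Proof.
move=> a0 lr omr v0 vE wv.
have lom : lam + om != 0.
  by apply: contra omr => /eqP/eqP; rewrite addrC addr_eq0 => /eqP ->; rewrite rpredN.
have lom' : lam + om^* != 0.
  have -> : lam + om^* = (lam + om)^* by rewrite rmorphD /= (CrealP lr).
  by rewrite conjC_eq0.
have om0 : om != 0 by apply: contraNneq omr => ->; exact: real0.
pose b := a^*; pose u k := v (inord k) 0.
have b0 : b != 0 by rewrite conjC_eq0.
have q0 : b * (lam + om^*) != 0 by rewrite mulf_neq0.
have eigen k : (k < N.+1)%N ->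
    om * (a * \sum_(k.+1 <= j < N.+1) a ^+ (j - k.+1) * u j)
    + om^* * \sum_(0 <= j < k) b ^+ (k - j) * u j = lam * u k.
  move=> kN; have /matrixP/(_ (Ordinal kN) 0) := vE.
  rewrite mulmxDl -!scalemxAl !mxE [u k]/u (_ : inord k = Ordinal kN); last first.
    by apply/val_inj; rewrite /= inordK.
  move=> <-; congr (_ * _ + _ * _).
    rewrite -(eq_big_ord_lt _ kN) mulr_sumr; apply: eq_bigr => j _.
    rewrite !mxE /= /u inord_val; case: ifP => kj; last by rewrite mul0r mulr0.
    by rewrite mulrA -exprS subnSK.
  rewrite -(eq_big_ord_gt _ kN); apply: eq_bigr => j _.
  rewrite !mxE /= /u inord_val; case: ifP => kj; last by rewrite rmorph0 mul0r.
  by rewrite rmorphXn.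
have yN : \sum_(N <= j < N.+1) a ^+ (j - N) * u j != 0.
  apply: contra v0 => /eqP yN; apply/eqP/matrixP => i j; rewrite !ord1 mxE.
  by have := kms_eigen_last eigen q0 yN (ltn_ord i); rewrite /u inord_val.
exists (a * (lam + om) / (b * (lam + om^*))), (lam / (b * (lam + om^*))).
eexists; split; [|reflexivity|exact: kms_eigen_lucas eigen q0 yN| |].
- by rewrite mulf_neq0 ?invr_eq0 ?mulf_neq0.
- apply: (kms_eigen_ortho eigen q0 (w := fun k => w 0 (inord k)) yN).
  have /matrixP/(_ 0 0) := wv; rewrite !mxE => wv0; rewrite -[RHS]wv0.
  by apply: eq_bigr => k _; rewrite /u inord_val.
have om'0 : om^* != 0 by rewrite conjC_eq0.
rewrite -/b; move: (om^*) lom' om'0 q0 => om' lom' om'0 q0.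
have -> : a * (lam + om) / (b * (lam + om')) - a * (lam / (b * (lam + om')))
  = a * om / (b * (lam + om')) by field; rewrite ?b0 ?lom'.
have -> : 1 - b * (lam / (b * (lam + om'))) = om' / (lam + om') by field; rewrite ?b0 ?lom'.
by field; rewrite ?b0 ?lom' ?om'0.
Qed.

(** * Choice of om and strictness of the inclusion *)

Lemma left_kernel_row (F : fieldType) m n (V : 'M[F]_(n, m)) : (m < n)%N ->
  exists2 w : 'rV_n, w != 0 & w *m V = 0.
Proof.
move=> mn; exists (nz_row (kermx V)); last by apply/sub_kermxP; exact: nz_row_sub.
rewrite nz_row_eq0 -mxrank_eq0 mxrank_ker subn_eq0 -ltnNge.
exact: leq_ltn_trans (rank_leq_col V) mn.
Qed.

(** Pigeonhole on om = k + i for natural k: the quotients (k + i) / (k - i) are pairwise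
    distinct. *)
Lemma infinite_slopes (C : numClosedFieldType) (s : seq C) :
  exists2 om : C, om \isn't Num.real & om / om^* \notin s.
Proof.
pose om k : C := k%:R + 'i.
have omC k : (om k)^* = k%:R - 'i by rewrite rmorphD /= conjCi conjC_nat.
have i0 : 'i != 0 :> C by exact: neq0Ci.
have omr k : om k \isn't Num.real.
  apply/CrealP; rewrite omC => /addrI/eqP.
  by rewrite -subr_eq0 -opprD oppr_eq0 -mulr2n mulrn_eq0 (negbTE i0).
have om'0 k : k%:R - 'i != 0 :> C.
  by rewrite -omC conjC_eq0; apply: contra (omr k) => /eqP ->; exact: real0.
have inj : injective (fun k => om k / (om k)^*).
  move=> j k /eqP; rewrite !omC eqr_div // -subr_eq0 => /eqP e.
  have : 'i * (k%:R - j%:R) *+ 2 = 0 :> C by rewrite -[RHS]e /om; ring.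
  move/eqP; rewrite mulrn_eq0 mulf_eq0 (negbTE i0) /= subr_eq0 eqr_nat.
  by move=> /eqP.
have [sub|/allPn[k _ ks]] :=
  boolP (all (fun k => om k / (om k)^* \in s) (iota 0 (size s).+1)); last first.
  by exists (om k).
have : (size (map (fun k => om k / (om k)^* ) (iota 0 (size s).+1)) <= size s)%N.
  apply: uniq_leq_size; first by rewrite map_inj_uniq ?iota_uniq.
  by move=> _ /mapP[k /(allP sub) ks ->].
by rewrite size_map size_iota ltnn.
Qed.

Theorem proposition3p1 (R : realType) (m n : nat)
  (m_ge1 : (1 <= m)%N) (lt_mn : (m < n)%N)
  (a : R[i]) (a_neq0 : a <> 0)
  (A : 'M[R[i]]_m) (compA : compression A (KMS n a)) :
  numrange A `<` numrange (KMS n a).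
Proof.
case: compA => V [VV ->] {A m_ge1}.
have compr (u : 'cV_m) : (u ^t* *m (V ^t* *m KMS n a *m V) *m u
    = (V *m u) ^t* *m KMS n a *m (V *m u))%sesqui.
  by rewrite trmxC_mul !mulmxA.
split=> [z /numrangeP[u [u1 uz]]|sub].
  apply/numrangeP; exists (V *m u); split; last by rewrite -compr.
  by rewrite isometry_norm.
case: n => [//|N] in lt_mn V VV compr sub *.
have /eqP a0 := a_neq0; have b0 : a^* != 0 by rewrite conjC_eq0.
have [w w0 wV] := left_kernel_row V lt_mn.
(* The coefficients are reversed to match the weights in [kms_eigen_ortho]. *)
pose g := \poly_(k < N.+1) w 0 (inord (N - k)).
have gE (k : 'I_N.+1) : g`_k = w 0 (inord (N - k)) by rewrite coef_poly ltn_ord.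
have g0 : g != 0.
  apply: contra w0 => /eqP g0; apply/eqP/matrixP => z i; rewrite ord1 mxE.
  have := gE (rev_ord i); rewrite g0 coef0 /= subSS subKn; last by rewrite -ltnS ltn_ord.
  by rewrite inord_val.
have [s sP] := finite_pencil_points a0 b0 g0 (size_poly _ _).
(* The excluded values are the slopes that the pairs in [s] produce through the last equation of
   [KMS_eigen_pencil]. *)
have [om omr oms] :=
  infinite_slopes [seq (a^* * (p.1 - a * p.2) / (1 - a^* * p.2)) / a | p <- s].
have [|lam [u [lamr Vu0 uE]]] := @isometry_top_eigenvector _ m N (KMS N.+1 a) V om VV.
  move=> x x1.
  have /sub/numrangeP[u [u1 uz]] : numrange (KMS N.+1 a) (((x ^t* )%sesqui *m KMS N.+1 a *m x) 0 0).
    by apply/numrangeP; exists x; split=> //; apply: mx11_scalar.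
  by exists u; split; rewrite // -compr uz -mx11_scalar.
have wVu : w *m (V *m u) = 0 by rewrite mulmxA wV mul0mx.
have [x [l [d [x0 dE lE gsum slope]]]] := KMS_eigen_pencil a0 lamr omr Vu0 uE wVu.
move/negP: oms; apply; apply/mapP; exists (x, l); last first.
  by rewrite /= -slope [RHS]mulrC mulKf.
apply: sP dE lE _ => //; rewrite -[RHS]gsum.
by apply: eq_bigr => k _; rewrite gE.
Qed.
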